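(* Let $n\ge 3$, let $m_1,\dots,m_n>0$ be real masses, let $m_{ij}=m_{ji}$ ($i\neq j$) be real coefficients and let $\alpha\in\mathbb{R}$. Let $\mathrm{CC}_1$ be the set of central configurations on the ellipsoid $E$, and let $f$ be the induced map from $X$ to $\mathbb{CP}^{n-2}$, with fixed point set $\mathrm{Fix}(f)$. Then the projection $p$, $z\mapsto [z]$, induces a homeomorphism $$\overline{\mathrm{CC}}=\mathrm{CC}_1/SO(2)\;\approx\;\mathrm{Fix}(f).$$
   Context: Let $n\ge 3$, $m_1,\dots,m_n>0$, and let $m_{ij}=m_{ji}\in\mathbb{R}$ for $i\ne j$. Let $\mathcal{X}=\{z\in\mathbb{C}^n:\sum_i m_iz_i=0\}$ and $\hat{\mathcal{X}}=\{z\in\mathcal{X}: z_i\neq z_j \text{ for } i\neq j\}$ (the configurations). For $\alpha\in\mathbb{R}$ let $U\colon\hat{\mathcal{X}}\to\mathbb{R}$, $U(z)=\sum_{i<j}m_{ij}\,\phi(z_i-z_j)$, where $\phi(z)=|z|^{\alpha+2}$ if $\alpha\neq-2$ and $\phi(z)=\log|z|$ if $\alpha=-2$. A central configuration is $z\in\hat{\mathcal{X}}$ for which there is a real $k\neq 0$ with $k\,m_iz_i=\partial U/\partial z_i$ for all $i$, where $\partial U/\partial z_i$ is the gradient with respect to $z_i\in\mathbb{C}\cong\mathbb{R}^2$. Equivalently, there is a real $\lambda\ne 0$ with $\hat f(z)=\lambda z$, where $\hat f\colon\hat{\mathcal{X}}\to\mathcal{X}$, $\hat f(z)=w$, $w_i=\sum_{j\neq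 i}m_i^{-1}m_{ij}|z_i-z_j|^{\alpha}(z_i-z_j)$. $E\subset\mathcal{X}$ is the ellipsoid $\sum_i m_i|z_i|^2=1$. $\mathrm{CC}_1$ is the set of central configurations lying in $E$; it is invariant under the diagonal action of $O(2)$ on $\mathbb{C}^n$ (with $O(2)$ acting on the plane $\mathbb{C}\cong\mathbb{R}^2$), and $\overline{\mathrm{CC}}=\mathrm{CC}_1/SO(2)$. Let $p\colon\mathbb{C}^n\setminus\{0\}\to\mathbb{CP}^{n-1}$, $p(z)=[z]=[z_1:\dots:z_n]$. Denote by $\mathbb{CP}^{n-2}$ the hyperplane $\sum_i m_iz_i=0$ of $\mathbb{CP}^{n-1}$, and let $X=p(\hat{\mathcal{X}})\subset\mathbb{CP}^{n-2}$. The map $f$ from $X$ to $\mathbb{CP}^{n-2}$ is $f([z])=[\hat f(z)]$, defined at those $[z]\in X$ with $\hat f(z)\neq 0$; $\mathrm{Fix}(f)$ is the set of $[z]\in X$ at which $f$ is defined and $f([z])=[z]$. *)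

(* Defs.v *)
From HB Require Import structures.
From mathcomp Require Import all_boot all_order all_algebra.
From mathcomp Require Import all_classical all_reals all_analysis.
From mathcomp Require Import complex.

Set Implicit Arguments.
Unset Strict Implicit.
Unset Printing Implicit Defensive.

Import Order.TTheory GRing.Theory Num.Theory numFieldNormedType.Exports.
Import ComplexField.

Local Open Scope classical_set_scope.
Local Open Scope ring_scope.
Local Open Scope complex_scope.
Local Open Scope quotient_scope.

Definition homeomorphism (S T : topologicalType) (h : S -> T) : Prop :=
  continuous h /\ exists g : T -> S, [/\ continuous g, cancel h g & cancel g h].

(* R[i] itself carries no topology in the libraries; its alias R[i]^o does. *)
Definition cvec (R : realType) (n : nat) := 'rV[R[i]^o]_n.

Section Configurations.
Variables (R : realType) (n : nat) (m : 'I_n -> R).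

Definition centered : set (cvec R n) :=
  [set z | \sum_i (m i)%:C * z 0 i = 0].

Definition configurations : set (cvec R n) :=
  [set z | centered z /\ forall i j, i != j -> z 0 i != z 0 j].

Definition ellipsoid : set (cvec R n) :=
  [set z | centered z /\ \sum_i m i * Normc.normc (z 0 i) ^+ 2 = 1].

End Configurations.

Section CentralConfigurations.
Variables (R : realType) (n : nat) (m : 'I_n -> R).
(* Only the values mm i j with i != j are ever used. *)
Variables (mm : 'I_n -> 'I_n -> R) (alpha : R).

Definition pot (w : R[i]) : R :=
  if alpha == - 2 then ln (Normc.normc w)
  else Normc.normc w `^ (alpha + 2).

Definition U (z : cvec R n) : R :=
  \sum_(i < n) \sum_(j < n | (i < j)%N) mm i j * pot (z 0 i - z 0 j).

(* Derivative at z of F when z_i moves along v in the plane R[i] = R^2. *)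
Definition partial_along (F : cvec R n -> R) (z : cvec R n) (i : 'I_n)
    (v : R[i]) : R :=
  derive1 (fun t : R => F (z + t%:C *: (v *: delta_mx 0 i : cvec R n))) 0.

Definition grad (F : cvec R n -> R) (z : cvec R n) (i : 'I_n) : R[i] :=
  partial_along F z i 1 +i* partial_along F z i 'i.

Definition central_configuration : set (cvec R n) :=
  [set z | configurations m z /\
    exists2 k : R, k != 0 & forall i, (k * m i)%:C * z 0 i = grad U z i].

Definition CC1 : set (cvec R n) := central_configuration `&` ellipsoid m.

Definition fhat (z : cvec R n) : cvec R n :=
  \row_i \sum_(j < n | j != i)
    ((m i)^-1 * mm i j * Normc.normc (z 0 i - z 0 j) `^ alpha)%:C
      * (z 0 i - z 0 j).

End CentralConfigurations.

Section RotationAction.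
Variables (R : realType) (n : nat).

Definition SO2 : set 'M[R]_2 := [set A | A *m A^T = 1%:M /\ \det A = 1].

Definition plane_act (A : 'M[R]_2) (w : R[i]) : R[i] :=
  (A 0 0 * complex.Re w + A 0 1 * complex.Im w)
    +i* (A 1 0 * complex.Re w + A 1 1 * complex.Im w).

Definition diag_act (A : 'M[R]_2) (z : cvec R n) : cvec R n :=
  \row_i plane_act A (z 0 i).

Lemma diag_act1 z : diag_act 1%:M z = z.
Proof.
apply/rowP => i; rewrite !mxE /plane_act !mxE /=.
by case: (z 0 i) => a b /=; rewrite !mul1r !mul0r addr0 add0r.
Qed.

Lemma diag_actM A B z : diag_act (A *m B) z = diag_act A (diag_act B z).
Proof.
apply/rowP => i; rewrite !mxE /plane_act !mxE !big_ord_recl !big_ord0 /=.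
have -> : lift ord0 ord0 = 1 :> 'I_2 by exact/val_inj.
rewrite !addr0; congr (_ +i* _); rewrite !mulrDl !mulrDr !mulrA;
  by rewrite -!addrA; congr (_ + _); rewrite addrCA.
Qed.

Lemma SO2_1 : SO2 1%:M.
Proof. by split; rewrite ?trmx1 ?mulmx1 ?det1. Qed.

Lemma SO2_M A B : SO2 A -> SO2 B -> SO2 (A *m B).
Proof.
move=> [AA dA] [BB dB]; split; last by rewrite det_mulmx dA dB mulr1.
by rewrite trmx_mul mulmxA -(mulmxA A B) BB mulmx1.
Qed.

Lemma SO2_tr A : SO2 A -> SO2 A^T.
Proof.
by move=> [AA dA]; split; rewrite ?det_tr// trmxK; exact: mulmx1C.
Qed.

End RotationAction.

Section CCbar.
Variables (R : realType) (n : nat) (m : 'I_n -> R).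
Variables (mm : 'I_n -> 'I_n -> R) (alpha : R).
Local Notation CC1 := (CC1 m mm alpha).

Definition rot_rel (y z : CC1) : bool :=
  `[< exists2 A, SO2 A & set_val y = diag_act A (set_val z) >].

Lemma rot_rel_refl : reflexive rot_rel.
Proof.
by move=> z; apply/asboolP; exists 1%:M; [exact: SO2_1|rewrite diag_act1].
Qed.

Lemma rot_rel_sym : symmetric rot_rel.
Proof.
suff H y z : rot_rel y z -> rot_rel z y.
  by move=> y z; apply/idP/idP; exact: H.
move=> /asboolP[A SA yz]; apply/asboolP; exists A^T; first exact: SO2_tr.
rewrite yz -diag_actM; have [AA _] := SA.
by rewrite (mulmx1C AA) diag_act1.
Qed.

Lemma rot_rel_trans : transitive rot_rel.
Proof.
move=> y x z /asboolP[A SA xy] /asboolP[B SB yz]; apply/asboolP.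
by exists (A *m B); [exact: SO2_M|rewrite diag_actM -yz].
Qed.

Canonical rot_equiv := EquivRel rot_rel rot_rel_refl rot_rel_sym rot_rel_trans.

Definition CCbar := quotient_topology {eq_quot rot_equiv}.
HB.instance Definition _ := Topological.on CCbar.
HB.instance Definition _ := Quotient.on CCbar.

End CCbar.

Section ProjectiveSpace.
Variables (R : realType) (n : nat).

Definition punctured : set (cvec R n) := [set z | z != 0].

Definition proj_rel (y z : punctured) : bool :=
  `[< exists2 c : R[i], c != 0 & set_val y = c *: (set_val z : cvec R n) >].

Lemma proj_rel_refl : reflexive proj_rel.
Proof. by move=> z; apply/asboolP; exists 1; rewrite ?oner_neq0// scale1r. Qed.

Lemma proj_rel_sym : symmetric proj_rel.
Proof.
suff H y z : proj_rel y z -> proj_rel z y.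
  by move=> y z; apply/idP/idP; exact: H.
move=> /asboolP[c c0 yz]; apply/asboolP; exists c^-1; first by rewrite invr_neq0.
by rewrite yz scalerA mulVf// scale1r.
Qed.

Lemma proj_rel_trans : transitive proj_rel.
Proof.
move=> y x z /asboolP[c c0 xy] /asboolP[d d0 yz]; apply/asboolP.
by exists (c * d); [rewrite mulf_neq0|rewrite -scalerA -yz].
Qed.

Canonical proj_equiv :=
  EquivRel proj_rel proj_rel_refl proj_rel_sym proj_rel_trans.

(* The space of lines of C^n, that is CP^(n-1). *)
Definition CP := quotient_topology {eq_quot proj_equiv}.
HB.instance Definition _ := Topological.on CP.
HB.instance Definition _ := Quotient.on CP.

Definition p (z : punctured) : CP := \pi_CP z.

End ProjectiveSpace.

Arguments punctured R n : clear implicits.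

Section FixedPoints.
Variables (R : realType) (n : nat) (m : 'I_n -> R).
Variables (mm : 'I_n -> 'I_n -> R) (alpha : R).
Local Notation CP := (CP R n).

(* CP^(n-2) *)
Definition hyperplane : set CP := [set p z | z in set_val @^-1` centered m].

Definition X : set CP := [set p z | z in set_val @^-1` configurations m].

(* None is the value at the points where f is undefined. Independence from the  *)
(* representative is f_p, and f_hyperplane says that f takes values in CP^(n-2). *)
Definition f (q : CP) : option CP :=
  omap (@p R n) (insub (fhat m mm alpha (set_val (repr q)))).

Definition Fix : set CP := [set q | X q /\ f q = Some q].

Lemma fhatZ (c : R[i]) (z : cvec R n) :
  fhat m mm alpha (c *: z) =
  ((Normc.normc c `^ alpha)%:C * c) *: fhat m mm alpha z.
Proof.
apply/rowP => i; rewrite !mxE mulr_sumr; apply: eq_bigr => j _.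
rewrite !mxE -mulrBr Normc.normcM.
have n0 (w : R[i]) : 0 <= Normc.normc w by case: w => a b; exact: sqrtr_ge0.
rewrite powRM// !(rmorphM (real_complex R)) /=.
set a := _%:C; set b := _%:C; set d := _%:C; set e := _%:C; set w := _ - _.
have ac (x1 x2 x3 x4 x5 x6 : R[i]) :
    x1 * x2 * (x3 * x4) * (x5 * x6) = x3 * x5 * (x1 * x2 * x4 * x6).
  by rewrite [x1 * x2 * _]mulrCA mulrACA.
exact: ac.
Qed.

Lemma f_p (z : punctured R n) :
  f (p z) = omap (@p R n) (insub (fhat m mm alpha (set_val z))).
Proof.
have : repr (p z) = z %[mod_eq @proj_equiv R n] by rewrite reprK.
move=> /eqmodP/asboolP[c c0 zE].
rewrite /f zE fhatZ.
set d := (_ * c); set w := fhat _ _ _ _.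
have d0 : d != 0.
  rewrite mulf_neq0//; apply/eqP => -[] /powR_eq0_eq0/Normc.eq0_normc.
  exact/eqP.
have [w0|w0] := eqVneq w 0.
  by rewrite w0 scaler0.
have dw0 : d *: w != 0 by rewrite scaler_eq0 negb_or d0.
rewrite !insubT ?inE// => u v /=; congr Some; apply/eqmodP/asboolP.
by exists d.
Qed.

Lemma fhat_centered (z : cvec R n) :
  (forall i, m i != 0) -> (forall i j, i != j -> mm i j = mm j i) ->
  centered m (fhat m mm alpha z).
Proof.
move=> m0 mmC; rewrite /centered /=.
pose G i j : R[i] := (mm i j * Normc.normc (z 0 i - z 0 j) `^ alpha)%:C
  * (z 0 i - z 0 j).
have GN i j : i != j -> G i j = - G j i.
  by move=> ij; rewrite /G mmC// -opprB normcN mulrN.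
pose S : R[i] := \sum_i \sum_(j < n | j != i) G i j.
transitivity S.
  apply: eq_bigr => i _; rewrite mxE mulr_sumr; apply: eq_bigr => j _.
  have mk (k x : R) (w : R[i]) : k != 0 -> k%:C * ((k^-1 * x)%:C * w) = x%:C * w.
    by move=> k0; rewrite mulrA -(rmorphM (real_complex R)) mulVKf.
  by rewrite -mulrA; exact: mk.
apply/eqP; rewrite -(eqNr S) /S; apply/eqP.
rewrite [RHS](exchange_big_dep xpredT)//= -sumrN.
apply: eq_bigr => i _; rewrite -sumrN.
by apply: eq_big => j; [rewrite eq_sym|move=> ji; rewrite GN 1?eq_sym// opprK].
Qed.

Lemma f_hyperplane (q r : CP) :
  (forall i, m i != 0) -> (forall i j, i != j -> mm i j = mm j i) ->
  f q = Some r -> hyperplane r.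
Proof.
move=> m0 mmC; rewrite /f; case: insubP => //= w _ wE [<-].
exists w => //=; rewrite [set_val w]wE; exact: fhat_centered.
Qed.

End FixedPoints.

Lemma CC1_punctured (R : realType) (n : nat) (m : 'I_n -> R)
    (mm : 'I_n -> 'I_n -> R) (alpha : R) (z : CC1 m mm alpha) :
  set_val z \in punctured R n.
Proof.
rewrite inE; apply/eqP => z0; have [_ [_]] := set_valP z; move: z0.
rewrite /= set_valE => ->; rewrite big1 => [/eqP|i _]; first by rewrite eq_sym oner_eq0.
by rewrite mxE Normc.normc0 expr0n mulr0.
Qed.

Definition punctured_of_CC1 (R : realType) (n : nat) (m : 'I_n -> R)
    (mm : 'I_n -> 'I_n -> R) (alpha : R) (z : CC1 m mm alpha) : punctured R n :=
  exist _ (set_val z) (CC1_punctured z).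

(* Main.v *)
Require Import Defs.
From HB Require Import structures.
From mathcomp Require Import all_boot all_order all_algebra.
From mathcomp Require Import all_classical all_reals all_analysis.
From mathcomp Require Import complex ring lra.

(** The gradient of [U] at a configuration is a nonzero real multiple of
    [m i * fhat z i], the factor being [alpha + 2], or [1] in the logarithmic
    case ([grad_U]).  A central configuration is therefore a configuration that
    is an eigenvector of [fhat] for a nonzero real eigenvalue
    ([central_configurationE]), and its line is fixed by [f].

    Conversely, a fixed line is spanned by a configuration [z] with
    [fhat z = c z] for a nonzero complex [c], and two facts turn [z] into an
    element of [CC1].  Pairing [fhat z] with [z] in the hermitian product
    weighted by the masses gives a real number, because the coefficients [mm]
    are symmetric; since it is also [c] times the positive moment of inertia,
    [c] is real ([fhat_eigenvalue_real]).  And [fhat] is homogeneous with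
    positive real factors under positive real dilations, so [z] can be rescaled
    to the ellipsoid ([normalize_Fix]).

    The representatives of one line that lie on the ellipsoid differ by a
    complex factor of modulus one, that is, by a rotation ([SO2_orbitP],
    [CC1_orbitP]).  So [p] induces a bijection from [CCbar] to [Fix].  It is
    continuous since [p] is.  Its inverse is continuous because rescaling to
    the ellipsoid is continuous on nonzero vectors and [p], being the quotient
    map of an action by homeomorphisms, is open ([p_open]). *)

Import Order.TTheory GRing.Theory Num.Theory.
Local Open Scope ring_scope.
Local Open Scope quotient_scope.

(** * The gradient of the potential *)

Section PotentialGradient.
Set Implicit Arguments.
Unset Strict Implicit.
Import numFieldNormedType.Exports.
Local Open Scope classical_set_scope.
Local Open Scope complex_scope.

Lemma normcE (R : rcfType) (w : R[i]) :
  Normc.normc w = Num.sqrt (complex.Re w ^+ 2 + complex.Im w ^+ 2).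
Proof. by case: w. Qed.

Lemma sqr_normcE (R : rcfType) (w : R[i]) :
  Normc.normc w ^+ 2 = complex.Re w ^+ 2 + complex.Im w ^+ 2.
Proof. by rewrite normcE sqr_sqrtr// addr_ge0// sqr_ge0. Qed.

Lemma normc_gt0 (R : rcfType) (w : R[i]) : w != 0 -> 0 < Normc.normc w.
Proof.
move=> w0; rewrite lt0r normcE sqrtr_ge0 andbT -normcE.
by apply: contra w0 => /eqP /Normc.eq0_normc ->.
Qed.

Definition potential_factor (R : realType) (alpha : R) : R :=
  if alpha == - 2 then 1 else alpha + 2.

Lemma potential_factor_neq0 (R : realType) (alpha : R) :
  potential_factor alpha != 0.
Proof.
rewrite /potential_factor; case: ifPn => [_|]; first exact: oner_neq0.
by rewrite addr_eq0.
Qed.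

(** Factoring the modulus as the square root of a quadratic polynomial in [t]
    lets the chain rule treat the logarithmic and the power potential alike:
    only the outermost function changes. *)
Lemma is_derive_pot (R : realType) (alpha : R) (w v : R[i]) : w != 0 ->
  is_derive (0 : R) 1 (fun t : R => pot alpha (w + t%:C * v))
    (potential_factor alpha * Normc.normc w `^ alpha
      * (complex.Re w * complex.Re v + complex.Im w * complex.Im v)).
Proof.
case: w => a b; case: v => p r w0.
have N0 := normc_gt0 w0.
pose q (t : R) := (a + t * p) ^+ 2 + (b + t * r) ^+ 2.
have Nq : Normc.normc (a +i* b) = Num.sqrt (q 0).
  by rewrite normcE /q /= !mul0r !addr0.
have q0 : 0 < q 0 by rewrite -sqrtr_gt0 -Nq.
have dq : is_derive (0 : R) 1 q (2 * (a * p + b * r)).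
  rewrite /q; apply: is_derive_eq.
  by rewrite /GRing.scale /=; ring.
have ds := is_derive1_comp (is_derive1_sqrt q0) dq.
have s0 : 0 < (Num.sqrt \o q) 0 by rewrite /= -Nq.
have qE : (fun t : R => pot alpha (a +i* b + t%:C * (p +i* r))) =
    (fun s => if alpha == -2 then ln s else s `^ (alpha + 2)) \o (Num.sqrt \o q).
  apply/funext => t; rewrite /pot normcE /= /q.
  by rewrite !mul0r subr0 addr0.
rewrite qE /potential_factor.
set N := Normc.normc _ in N0 Nq *.
have Nn0 : N != 0 by rewrite gt_eqF.
case: ifPn => [/eqP ->|a2].
  apply: is_derive_eq; first exact: (is_derive1_comp (is_derive1_ln s0) ds).
  rewrite /= -Nq powR_invn ?ltW //.
  by field.
apply: is_derive_eq; first exact: (is_derive1_comp (is_derive1_powR _ s0) ds).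
rewrite /= -Nq.
have -> : alpha + 2 - 1 = alpha + 1 by ring.
rewrite powRD ?Nn0 ?implybT // powRr1 ?ltW //.
by field.
Qed.

Lemma is_derive_bigsum (R : realType) (I : Type) (r : seq I) (P : pred I)
    (F : I -> R -> R) (dF : I -> R) (x : R) :
  (forall i, P i -> is_derive x 1 (F i) (dF i)) ->
  is_derive x 1 (fun t => \sum_(i <- r | P i) F i t) (\sum_(i <- r | P i) dF i).
Proof.
move=> dFi.
have -> : (fun t => \sum_(i <- r | P i) F i t) = \sum_(i <- r | P i) F i.
  by rewrite fct_sumE.
elim/big_ind2 : _ => // [|f df g dg fP gP]; first exact: is_derive_cst.
exact: is_deriveD.
Qed.

(** Moving the single point [i] changes only the pairs that contain [i], with
    sign [+] if [i] is the smaller index of the pair and [-] if it is the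
    larger one; antisymmetry of [G] absorbs that sign. *)
Lemma sum_incident_pairs (R : comPzRingType) (n : nat) (G : 'I_n -> 'I_n -> R)
    (i : 'I_n) :
  (forall k l, k != l -> G k l = - G l k) ->
  \sum_(k < n) \sum_(l < n | (k < l)%N) G k l * ((k == i)%:R - (l == i)%:R)
    = \sum_(l < n | l != i) G i l.
Proof.
move=> GC.
have -> : \sum_(k < n) \sum_(l < n | (k < l)%N) G k l * ((k == i)%:R - (l == i)%:R)
  = \sum_(k < n) \sum_(l < n | (k < l)%N) G k l * (k == i)%:R
    - \sum_(k < n) \sum_(l < n | (k < l)%N) G k l * (l == i)%:R.
  rewrite -sumrB; apply: eq_bigr => k _; rewrite -sumrB.
  by apply: eq_bigr => l _; rewrite mulrBr.
have -> : \sum_(k < n) \sum_(l < n | (k < l)%N) G k l * (k == i)%:R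
    = \sum_(l < n | (i < l)%N) G i l.
  rewrite (bigD1 i) //= [X in _ + X = _]big1 ?addr0.
    by apply: eq_bigr => l _; rewrite eqxx mulr1.
  by move=> k /negPf ki; rewrite big1 // => l _; rewrite ki mulr0.
have -> : \sum_(k < n) \sum_(l < n | (k < l)%N) G k l * (l == i)%:R
    = \sum_(k < n | (k < i)%N) G k i.
  rewrite (exchange_big_dep xpredT) //= (bigD1 i) //= [X in _ + X = _]big1 ?addr0.
    by apply: eq_bigr => l _; rewrite eqxx mulr1.
  by move=> k /negPf ki; rewrite big1 // => l _; rewrite ki mulr0.
rewrite [RHS](bigID (fun l : 'I_n => (i < l)%N)) /= -sumrN; congr (_ + _).
  by apply: eq_bigl => l; rewrite -val_eqE neq_ltn; case: ltngtP.
apply: eq_big => [l|l li]; first by rewrite -val_eqE neq_ltn; case: ltngtP.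
by rewrite [RHS]GC // -val_eqE neq_ltn li orbT.
Qed.

(** The term of the pair [k < l] depends on the displacement of point [i] through
    the difference [z k - z l], which moves along [v] times
    [(k == i) - (l == i)]. *)
Lemma partial_along_U (R : realType) (n : nat) (mm : 'I_n -> 'I_n -> R) (alpha : R)
    (z : cvec R n) (i : 'I_n) (v : R[i]) :
  (forall k l, k != l -> z 0 k != z 0 l) ->
  (forall k l, k != l -> mm k l = mm l k) ->
  partial_along (U mm alpha) z i v =
  \sum_(l < n | l != i) potential_factor alpha
     * (mm i l * Normc.normc (z 0 i - z 0 l) `^ alpha)
     * (complex.Re (z 0 i - z 0 l) * complex.Re v
        + complex.Im (z 0 i - z 0 l) * complex.Im v).
Proof.
move=> zz mmC; rewrite /partial_along derive1E.
apply: derive_val.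
pose G k l : R := potential_factor alpha
     * (mm k l * Normc.normc (z 0 k - z 0 l) `^ alpha)
     * (complex.Re (z 0 k - z 0 l) * complex.Re v
        + complex.Im (z 0 k - z 0 l) * complex.Im v).
apply: is_derive_eq; last first.
  apply: (@sum_incident_pairs _ _ G) => k l kl.
  rewrite /G mmC // -opprB normcN; move: (z 0 l - z 0 k) => [c d] /=.
  by ring.
apply: is_derive_bigsum => k _; apply: is_derive_bigsum => l kl.
have kl' : k != l by rewrite neq_ltn kl.
pose e : R := (k == i)%:R - (l == i)%:R.
have -> : (fun t : R => mm k l * pot alpha
     ((z + t%:C *: (v *: delta_mx 0 i : cvec R n)) 0 k
       - (z + t%:C *: (v *: delta_mx 0 i : cvec R n)) 0 l))
  = mm k l \*: (fun t : R => pot alpha (z 0 k - z 0 l + t%:C * (e%:C * v))).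
  apply/funext => t; rewrite /= /GRing.scale /=; congr (_ * pot _ _).
  rewrite !mxE eqxx /= /e rmorphB /= !rmorph_nat.
  have distr (x y t' u a b : R[i]) :
    x + t' * (u * a) - (y + t' * (u * b)) = x - y + t' * ((a - b) * u) by ring.
  exact: distr.
apply: is_derive_eq.
  apply: is_deriveZ; apply: is_derive_pot; by rewrite subr_eq0 zz.
rewrite /G /GRing.scale /= -/e.
case: v {G} => c d /=; ring.
Qed.

Lemma Re_sum (R : rcfType) (I : Type) (r : seq I) (P : pred I) (F : I -> R[i]) :
  complex.Re (\sum_(i <- r | P i) F i) = \sum_(i <- r | P i) complex.Re (F i).
Proof. by apply: (big_morph (@complex.Re R)) => // -[a b] [c d]. Qed.

Lemma Im_sum (R : rcfType) (I : Type) (r : seq I) (P : pred I) (F : I -> R[i]) :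
  complex.Im (\sum_(i <- r | P i) F i) = \sum_(i <- r | P i) complex.Im (F i).
Proof. by apply: (big_morph (@complex.Im R)) => // -[a b] [c d]. Qed.

Lemma grad_U (R : realType) (n : nat) (m : 'I_n -> R) (mm : 'I_n -> 'I_n -> R)
    (alpha : R) (z : cvec R n) (i : 'I_n) :
  (forall k l, k != l -> z 0 k != z 0 l) ->
  (forall k l, k != l -> mm k l = mm l k) -> m i != 0 ->
  grad (U mm alpha) z i =
  (potential_factor alpha * m i)%:C * fhat m mm alpha z 0 i.
Proof.
move=> zz mmC m0; rewrite /grad !partial_along_U //.
rewrite /fhat mxE mulr_sumr; apply/eqP; rewrite eq_complex Re_sum Im_sum /=.
apply/andP; split; apply/eqP; apply: eq_bigr => l li;
  move: (Normc.normc _ `^ _) => N; case: (z 0 i - z 0 l) => x y /=; field; exact: m0.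
Qed.

End PotentialGradient.

(** * Central configurations as eigenvectors *)

Section Eigenvectors.
Set Implicit Arguments.
Unset Strict Implicit.
Local Open Scope complex_scope.

(** The nonzero factor relating the gradient to [fhat] moves between the
    multiplier [k] and the eigenvalue, so neither can vanish without the
    other. *)
Lemma central_configurationE (R : realType) (n : nat) (m : 'I_n -> R)
    (mm : 'I_n -> 'I_n -> R) (alpha : R) (z : cvec R n) :
  (forall i, 0 < m i) -> (forall k l, k != l -> mm k l = mm l k) ->
  central_configuration m mm alpha z <->
  configurations m z /\
  exists2 lam : R, lam != 0 & fhat m mm alpha z = lam%:C *: z.
Proof.
move=> m0 mmC; have mn0 i : m i != 0 by rewrite gt_eqF.
have c0 := potential_factor_neq0 alpha.
split=> -[cz [k k0 kz]]; (split=> //; have [_ zz] := cz).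
- exists (k / potential_factor alpha); first by rewrite mulf_neq0 ?invr_neq0.
  apply/rowP => i; have := kz i; rewrite (grad_U _ zz mmC (mn0 i)) => e.
  have cm : (potential_factor alpha * m i)%:C != 0 :> R[i].
    by rewrite (inj_eq (@complexI R)) mulf_neq0.
  apply: (mulfI cm); rewrite -e mxE mulrA -rmorphM /=.
  by congr (_%:C * _); field.
- exists (k * potential_factor alpha); first by rewrite mulf_neq0.
  move=> i; rewrite (grad_U _ zz mmC (mn0 i)) kz mxE mulrA -rmorphM /=.
  by congr (_%:C * _); ring.
Qed.

(** The quadratic form whose unit level set, among centered vectors, is the
    ellipsoid. *)
Definition inertia (R : realType) (n : nat) (m : 'I_n -> R) (z : cvec R n) : R :=
  \sum_i m i * Normc.normc (z 0 i) ^+ 2.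

Lemma inertia_gt0 (R : realType) (n : nat) (m : 'I_n -> R) (z : cvec R n) :
  (forall i, 0 < m i) -> z != 0 -> 0 < inertia m z.
Proof.
move=> m0 /rV0Pn [i zi].
rewrite /inertia (bigD1 i) //= ltr_pwDl //.
  by rewrite mulr_gt0 // exprn_gt0 // normc_gt0.
by apply: sumr_ge0 => j _; rewrite mulr_ge0 ?sqr_ge0 // ltW.
Qed.

Lemma inertiaZ (R : realType) (n : nat) (m : 'I_n -> R) (c : R[i]) (z : cvec R n) :
  inertia m (c *: z) = Normc.normc c ^+ 2 * inertia m z.
Proof.
rewrite /inertia mulr_sumr; apply: eq_bigr => i _.
by rewrite mxE Normc.normcM exprMn mulrCA.
Qed.

(** In the imaginary part of the hermitian product of [fhat z] with [z], the
    terms of the pairs [(i, j)] and [(j, i)] cancel, because the force between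
    two points is directed along the line joining them.  The same product is
    [c] times the moment of inertia, which is positive. *)
Lemma fhat_eigenvalue_real (R : realType) (n : nat) (m : 'I_n -> R)
    (mm : 'I_n -> 'I_n -> R) (alpha : R) (z : cvec R n) (c : R[i]) :
  (forall i, 0 < m i) -> (forall k l, k != l -> mm k l = mm l k) -> z != 0 ->
  fhat m mm alpha z = c *: z -> complex.Im c = 0.
Proof.
move=> m0 mmC z0 zE.
have : complex.Im (\sum_i (m i)%:C * fhat m mm alpha z 0 i * (z 0 i)^* ) = 0.
  (* The imaginary part of the contribution of the force of j on i. *)
  pose G i j : R := mm i j * Normc.normc (z 0 i - z 0 j) `^ alpha
    * complex.Im ((z 0 i - z 0 j) * (z 0 i)^* ).
  have GC i j : j != i -> G i j = - G j i.
    move=> ij; rewrite /G (mmC j i ij) -(opprB (z 0 i)) normcN.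
    move: (_ `^ _) => N; case: (z 0 i) => a b; case: (z 0 j) => x y /=; ring.
  transitivity (\sum_i \sum_(j < n | j != i) G i j).
    rewrite Im_sum; apply: eq_bigr => i _.
    rewrite mxE mulr_sumr mulr_suml Im_sum; apply: eq_bigr => j ji.
    rewrite /G; move: (_ `^ _) => N.
    move: (z 0 i - z 0 j) => [a b]; move: (z 0 i) => [x y] /=.
    by field; rewrite gt_eqF.
  apply/eqP; rewrite -eqNr; apply/eqP; rewrite [RHS](exchange_big_dep xpredT)//=.
  rewrite -sumrN; apply: eq_bigr => i _; rewrite -sumrN.
  by apply: eq_big => j; [rewrite eq_sym|move=> ji; rewrite GC ?opprK // eq_sym].
have -> : \sum_i (m i)%:C * fhat m mm alpha z 0 i * (z 0 i)^*%C = c * (inertia m z)%:C.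
  rewrite zE /inertia rmorph_sum mulr_sumr; apply: eq_bigr => i _.
  rewrite mxE sqr_normcE; case: c {zE} => p q; case: (z 0 i) => a b.
  by apply/eqP; rewrite eq_complex /=; apply/andP; split; apply/eqP; ring.
have := inertia_gt0 m0 z0; move: (inertia m z) => Q Q0.
case: c {zE} => p q /=; rewrite mulr0 add0r => /eqP.
by rewrite mulf_eq0 (gt_eqF Q0) orbF => /eqP.
Qed.

End Eigenvectors.

(** * Rotations as unit complex scalars *)

Section Rotations.
Set Implicit Arguments.
Unset Strict Implicit.
Local Open Scope complex_scope.

Lemma big_ord2 (R : nmodType) (F : 'I_2 -> R) : \sum_(i < 2) F i = F 0 + F 1.
Proof.
rewrite !big_ord_recl big_ord0 addr0; congr (_ + F _); exact/val_inj.
Qed.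

Lemma det_mx2 (R : comPzRingType) (A : 'M[R]_2) :
  \det A = A 0 0 * A 1 1 - A 0 1 * A 1 0.
Proof.
rewrite (expand_det_row _ 0) big_ord2 /cofactor !det_mx11 !mxE /=.
rewrite expr0 expr1 mul1r mulN1r mulrN.
by congr (A _ _ * A _ _ - A _ _ * A _ _); exact/val_inj.
Qed.

(** A rotation matrix has columns [(a, b)] and [(- b, a)], which is the matrix of
    multiplication by [a + b i]. *)
Lemma SO2_orbitP (R : realType) (n : nat) (y z : cvec R n) :
  (exists2 A, SO2 A & y = diag_act A z) <->
  (exists2 c : R[i], Normc.normc c = 1 & y = c *: z).
Proof.
split.
- case=> A [AAT dA] ->.
  move: dA; rewrite det_mx2 => dA.
  have e00 : A 0 0 ^+ 2 + A 0 1 ^+ 2 = 1.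
    by have /matrixP/(_ 0 0) := AAT; rewrite !mxE big_ord2 !mxE.
  have e11 : A 1 0 ^+ 2 + A 1 1 ^+ 2 = 1.
    by have /matrixP/(_ 1 1) := AAT; rewrite !mxE big_ord2 !mxE.
  have [ad bc] : A 1 1 = A 0 0 /\ A 0 1 = - A 1 0.
    (* The sum of the squares is (1 + 1) - 2 det A, by the two row norms. *)
    have : (A 1 1 - A 0 0) ^+ 2 + (A 0 1 + A 1 0) ^+ 2 = 0 by nra.
    move/eqP; rewrite paddr_eq0 ?sqr_ge0 // !sqrf_eq0 subr_eq0 addr_eq0.
    by case/andP => /eqP -> /eqP ->.
  exists (A 0 0 +i* A 1 0).
    rewrite normcE /= -[X in _ = X]sqrtr1 -e00 bc; congr Num.sqrt; ring.
  apply/rowP => i; rewrite !mxE /plane_act ad bc.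
  by case: (z 0 i) => a b /=; apply/eqP; rewrite eq_complex /=; apply/andP; split;
    apply/eqP; ring.
- case=> -[a b] c1 ->.
  have ab : a ^+ 2 + b ^+ 2 = 1 by have := sqr_normcE (a +i* b); rewrite c1 expr1n.
  exists (\matrix_(i < 2, j < 2)
    if i == j then a else if i == 0 then - b else b).
    split; last by rewrite det_mx2 !mxE /= -ab; ring.
    apply/matrixP => i j; rewrite !mxE big_ord2 !mxE.
    case: i => -[|[|//]] ?; case: j => -[|[|//]] ? /=;
      rewrite ?mulr1n ?mulr0n ?mulrNN ?mulNr ?mulrN -?ab; ring.
  apply/rowP => i; rewrite !mxE /plane_act !mxE /=.
  by case: (z 0 i) => x x' /=; apply/eqP; rewrite eq_complex /=; apply/andP; split;
    apply/eqP; ring.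
Qed.

End Rotations.

(** * Rescaling to the ellipsoid and openness of the projection *)

Section NormalizationTopology.
Set Implicit Arguments.
Unset Strict Implicit.
Import numFieldNormedType.Exports.
Local Open Scope classical_set_scope.
Local Open Scope complex_scope.

Lemma normC_normc (R : rcfType) (w : R[i]) : `|w| = (Normc.normc w)%:C.
Proof. by rewrite normc_def normcE. Qed.

Lemma normc_continuous (R : realType) :
  continuous (fun w : R[i]^o => Normc.normc w).
Proof.
move=> w.
apply: (@cvgrPdist_lt R R R[i]^o (nbhs w) (nbhs_filter w)
  (fun w : R[i]^o => Normc.normc w) (Normc.normc w)).2 => e e0.
have e0' : (0 : R[i]) < e%:C by rewrite ltcR.
have : \forall v \near w, `|w - v| < e%:C.
  by apply/nbhs_ballP; exists e%:C.
apply: filterS => v; rewrite normC_normc ltcR; apply: le_lt_trans.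
rewrite ler_norml.
have h1 := le_normcD (w - v) v; rewrite subrK in h1.
have h2 := le_normcD (v - w) w; rewrite subrK -opprB normcN in h2.
by apply/andP; split; lra.
Qed.

Lemma real_complex_continuous (R : realType) :
  continuous (fun t : R => t%:C : R[i]^o).
Proof.
move=> t; apply: (@cvgrPdist_lt R[i] R[i]^o R (nbhs t) (nbhs_filter t)
  (fun t : R => t%:C : R[i]^o) _).2 => e e0.
have [d eE] : exists d, e = d%:C.
  by apply/complex_realP; rewrite realE ltW.
have d0 : 0 < d by rewrite -ltcR -eE.
have : \forall s \near t, `|t - s| < d by apply/nbhs_ballP; exists d.
apply: filterS => s ts.
by rewrite -rmorphB normC_normc eE ltcR normcE /= expr0n addr0 sqrtr_sqr.
Qed.

Lemma inertia_continuous (R : realType) (n : nat) (m : 'I_n -> R) :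
  continuous (inertia m : cvec R n -> R).
Proof.
rewrite (_ : inertia m =
  \sum_i (fun z : cvec R n => m i * Normc.normc (z 0 i) ^+ 2)); last first.
  by apply/funext => z; rewrite fct_sumE.
apply: (big_ind (fun f : cvec R n -> R => continuous f)) => [|f g cf cg|i _] z.
- by apply: cst_continuous.
- by apply: continuousD; [exact: cf|exact: cg].
- pose h (x : cvec R n) : R := Normc.normc (x 0 i).
  have ch : {for z, continuous h}.
    apply: (@continuous_comp _ _ _ (fun x : cvec R n => x 0 i)
      (fun w : R[i]^o => Normc.normc w)); last exact: normc_continuous.
    exact: coord_continuous.
  have ch2 : {for z, continuous (fun x => h x * h x)} by exact: continuousM.
  have cm : {for z, continuous (fun _ : cvec R n => m i)} by exact: cst_continuous.
  exact: continuousM cm ch2.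
Qed.

Definition normalize (R : realType) (n : nat) (m : 'I_n -> R) (z : cvec R n) :
  cvec R n := ((Num.sqrt (inertia m z))^-1)%:C *: z.

Lemma normalize_continuous (R : realType) (n : nat) (m : 'I_n -> R)
    (z : cvec R n) :
  0 < inertia m z -> {for z, continuous (normalize m)}.
Proof.
move=> z0.
have cs : {for z, continuous (fun z : cvec R n => (Num.sqrt (inertia m z))^-1)}.
  apply: continuousV; first by rewrite gt_eqF // sqrtr_gt0.
  apply: (@continuous_comp _ _ _ (inertia m : cvec R n -> R) (@Num.sqrt R)).
    exact: inertia_continuous.
  exact: sqrt_continuous.
have cc : {for z, continuous (fun z : cvec R n =>
    ((Num.sqrt (inertia m z))^-1)%:C : R[i]^o)}.
  apply: (@continuous_comp _ _ _ (fun z : cvec R n => (Num.sqrt (inertia m z))^-1)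
    (fun t : R => t%:C : R[i]^o)); first exact: cs.
  exact: real_complex_continuous.
have ci : {for z, continuous (fun z : cvec R n => z)} by apply: cvg_id.
exact: continuousZ cc ci.
Qed.

Lemma normalize_id (R : realType) (n : nat) (m : 'I_n -> R) (z : cvec R n) :
  inertia m z = 1 -> normalize m z = z.
Proof. by move=> z1; rewrite /normalize z1 sqrtr1 invr1 scale1r. Qed.

Lemma inertia_normalize (R : realType) (n : nat) (m : 'I_n -> R) (z : cvec R n) :
  0 < inertia m z -> inertia m (normalize m z) = 1.
Proof.
move=> z0; rewrite inertiaZ sqr_normcE /= expr0n addr0 exprVn sqr_sqrtr ?ltW //.
by rewrite mulVf // gt_eqF.
Qed.

(** Normalization is continuous only away from [0], so the preimage has to be cut
    down to nonzero vectors, on which the moment of inertia is positive. *)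
Lemma open_normalize_preimage (R : realType) (n : nat) (m : 'I_n -> R)
    (W : set (cvec R n)) :
  open W -> open [set z | 0 < inertia m z /\ W (normalize m z)].
Proof.
move=> oW; rewrite openE => z [z0 Wz]; apply: filterI.
- have /continuousP c := @inertia_continuous R n m.
  by apply: open_nbhs_nbhs; split=> //; exact: c _ (@open_gt R 0).
- by apply: (normalize_continuous z0); apply: open_nbhs_nbhs.
Qed.

(** The saturation of an open set under nonzero scalars is a union of preimages
    of that set under scalings, which are continuous. *)
Lemma p_open (R : realType) (n : nat) (O : set (cvec R n)) :
  open O -> open (@p R n @` (set_val @^-1` O)).
Proof.
move=> oO.
pose B := \bigcup_(c in [set c : R[i] | c != 0])
  (fun z : cvec R n => c *: z : cvec R n) @^-1` O.
exists B.
  apply: bigcup_open => c _.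
  have /continuousP : continuous (fun z : cvec R n => c *: z : cvec R n).
    exact: scaler_continuous.
  exact.
apply/seteqP; split=> [z [c c0 Oc]|z [y Oy yz]] /=.
- have cz0 : c *: (set_val z : cvec R n) \in punctured R n.
    have := set_valP z; rewrite inE /punctured /= => z0.
    by rewrite scaler_eq0 negb_or c0.
  exists (exist _ (c *: (set_val z : cvec R n)) cz0 : punctured R n) => //=.
  by apply/eqmodP/asboolP; exists c.
- move: yz => /eqmodP/asboolP[c c0 yz]; exists c => //=.
  by rewrite -yz.
Qed.

End NormalizationTopology.

(** * The bijection between rotation classes and fixed points *)

Section ClassesAndFixedPoints.
Set Implicit Arguments.
Unset Strict Implicit.
Import numFieldNormedType.Exports.
Local Open Scope classical_set_scope.
Local Open Scope complex_scope.

Lemma p_CC1_in_Fix (R : realType) (n : nat) (m : 'I_n -> R) (mm : 'I_n -> 'I_n -> R)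
    (alpha : R) (z : CC1 m mm alpha) :
  (forall i, 0 < m i) -> (forall k l, k != l -> mm k l = mm l k) ->
  p (punctured_of_CC1 z) \in Fix m mm alpha.
Proof.
move=> m0 mmC; rewrite inE; have [/(central_configurationE _ _ m0 mmC)] := set_valP z.
move=> [cz [lam lam0 zE]] _; split; first by exists (punctured_of_CC1 z).
have z0 : set_val z != 0 by have := CC1_punctured z; rewrite inE.
rewrite f_p /= zE.
have lz0 : lam%:C *: (set_val z : cvec R n) \in punctured R n.
  by rewrite inE /punctured /= scaler_eq0 negb_or (inj_eq (@complexI R)) lam0.
rewrite insubT /=; congr Some; apply/eqmodP/asboolP.
by exists lam%:C => //; rewrite (inj_eq (@complexI R)).
Qed.

Lemma configurationsZ (R : realType) (n : nat) (m : 'I_n -> R) (c : R[i])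
    (z : cvec R n) :
  c != 0 -> configurations m z -> configurations m (c *: z).
Proof.
move=> c0 [cz zz]; split=> [|i j /zz zij]; last first.
  by rewrite !mxE (inj_eq (mulfI c0)).
rewrite /centered /=.
have -> : \sum_i (m i)%:C * (c *: z) 0 i = c * \sum_i (m i)%:C * z 0 i.
  by rewrite mulr_sumr; apply: eq_bigr => i _; rewrite mxE mulrCA.
by rewrite cz mulr0.
Qed.

Lemma p_normalize (R : realType) (n : nat) (m : 'I_n -> R) (y z : punctured R n) :
  (forall i, 0 < m i) -> set_val y = normalize m (set_val z) -> p y = p z.
Proof.
move=> m0 yz; apply/eqmodP/asboolP.
exists ((Num.sqrt (inertia m (set_val z)))^-1)%:C => //.
have z0 : set_val z != 0 := set_valP z.
by rewrite (inj_eq (@complexI R)) invr_neq0 // gt_eqF // sqrtr_gt0 inertia_gt0.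
Qed.

(** Being a fixed point only gives a nonzero complex eigenvalue [c]; it is real by
    [fhat_eigenvalue_real], and rescaling by a positive [s] multiplies it by
    [s `^ alpha], so it stays real and nonzero. *)
Lemma normalize_Fix (R : realType) (n : nat) (m : 'I_n -> R)
    (mm : 'I_n -> 'I_n -> R) (alpha : R) (z : punctured R n) :
  (forall i, 0 < m i) -> (forall k l, k != l -> mm k l = mm l k) ->
  Fix m mm alpha (p z) -> CC1 m mm alpha (normalize m (set_val z)).
Proof.
move=> m0 mmC [[y cy yz] fz].
have z0 : set_val z != 0 := set_valP z.
have Iz := inertia_gt0 m0 z0.
have s0 : (Num.sqrt (inertia m (set_val z)))^-1 != 0.
  by rewrite invr_neq0 // gt_eqF // sqrtr_gt0.
have cN : configurations m (normalize m (set_val z)).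
  apply: configurationsZ; first by rewrite (inj_eq (@complexI R)).
  move: yz => /eqmodP/asboolP[c c0 yz].
  have -> : set_val z = c^-1 *: (set_val y : cvec R n).
    by rewrite yz scalerA mulVf // scale1r.
  by apply: configurationsZ cy; rewrite invr_eq0.
have [c c0 zE] : exists2 c : R[i], c != 0 & fhat m mm alpha (set_val z) = c *: set_val z.
  move: fz; rewrite f_p; case: insubP => //= w _ wE [] /eqmodP/asboolP[c c0 e].
  by exists c => //; rewrite -wE.
have c_real := fhat_eigenvalue_real m0 mmC z0 zE.
split; last by split; [case: cN|exact: inertia_normalize].
apply/(central_configurationE _ _ m0 mmC); split=> //.
set s := (Num.sqrt _)^-1 in s0.
exists (Normc.normc s%:C `^ alpha * complex.Re c).
  rewrite mulf_neq0 //.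
    apply/eqP => /powR_eq0_eq0/Normc.eq0_normc/complexI/eqP.
    exact/negP.
  apply: contra c0 => /eqP e; case: c c_real e {zE} => a b /= -> ->.
  exact: eqxx.
have cE : c = (complex.Re c)%:C by case: c c_real {c0 zE} => a b /= ->.
rewrite /normalize -/s fhatZ zE !scalerA; congr (_ *: _).
set N := _ `^ _.
by rewrite (rmorphM (real_complex R)) /= -cE mulrAC.
Qed.

(** Two points of the ellipsoid on one line have the same moment of inertia, which
    scales with the squared modulus of the factor; so this factor has modulus
    one. *)
Lemma CC1_orbitP (R : realType) (n : nat) (m : 'I_n -> R)
    (mm : 'I_n -> 'I_n -> R) (alpha : R) (y z : CC1 m mm alpha) :
  (\pi_(CCbar m mm alpha) y = \pi_(CCbar m mm alpha) z) <->
  p (punctured_of_CC1 y) = p (punctured_of_CC1 z).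
Proof.
split.
- move=> /eqmodP/asboolP/SO2_orbitP[c c1 yz]; apply/eqmodP/asboolP; exists c => //.
  by apply/eqP => c0; move: c1; rewrite c0 Normc.normc0 => /esym/eqP; rewrite oner_eq0.
- move=> /eqmodP/asboolP[c c0 yz]; apply/eqmodP/asboolP/SO2_orbitP.
  have [_ [_ Iy]] := set_valP y; have [_ [_ Iz]] := set_valP z.
  exists c => //; have : inertia m (c *: (set_val z : cvec R n)) = 1 by rewrite -yz.
  rewrite inertiaZ [inertia _ _]Iz mulr1.
  move/eqP; rewrite sqrf_eq1 => /orP[/eqP//|/eqP e].
  have := normc_gt0 c0; rewrite e; lra.
Qed.

End ClassesAndFixedPoints.

Theorem lemma1 (R : realType) (n : nat) (m : 'I_n -> R)
    (mm : 'I_n -> 'I_n -> R) (alpha : R) :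
  (3 <= n)%N ->
  (forall i, 0 < m i) ->
  (forall i j, i != j -> mm i j = mm j i) ->
  exists h : CCbar m mm alpha -> Fix m mm alpha,
    (forall z : CC1 m mm alpha,
       set_val (h (\pi_(CCbar m mm alpha) z)) = p (punctured_of_CC1 z)) /\
    homeomorphism h.
Proof.
move=> _ m0 mmC.
pose h (q : CCbar m mm alpha) : Fix m mm alpha :=
  exist _ (p (punctured_of_CC1 (repr q))) (p_CC1_in_Fix (repr q) m0 mmC).
have hE z : set_val (h (\pi_(CCbar m mm alpha) z)) = p (punctured_of_CC1 z).
  by apply/CC1_orbitP; rewrite reprK.
exists h; split=> //; split.
  apply/quotient_continuous.
  apply: (@continuous_comp_initial _ _ _ set_val).
  have -> : set_val \o (h \o \pi_(CCbar m mm alpha))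
      = @p R n \o @punctured_of_CC1 R n m mm alpha.
    by apply/funext => z; rewrite /= hE.
  move=> z; apply: continuous_comp; last exact: pi_continuous.
  apply: (@continuous_comp_initial _ _ _ set_val).
  exact: initial_continuous.
have inj_h : injective h.
  move=> q r; rewrite -[q]reprK -[r]reprK => /(congr1 set_val); rewrite !hE.
  by move/CC1_orbitP.
have lift (q : Fix m mm alpha) :
    exists y : CC1 m mm alpha, p (punctured_of_CC1 y) = set_val q.
  have Fz : Fix m mm alpha (p (repr (set_val q))).
    rewrite -[p _]/(\pi_(CP R n) _) reprK; exact: set_valP.
  have [z zE] : exists z : CC1 m mm alpha,
      set_val z = normalize m (set_val (repr (set_val q))).
    by exists (exist _ (normalize m (set_val (repr (set_val q))))
         (mem_set (normalize_Fix m0 mmC Fz))).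
  exists z; rewrite (@p_normalize _ _ m _ (repr (set_val q))) //.
  by rewrite /p reprK.
(* The inverse rescales a representative of the line to the ellipsoid; which
   representative is chosen does not matter, by injectivity. *)
have [s sE] := choice lift.
pose g q := \pi_(CCbar m mm alpha) (s q).
have hg : cancel g h by move=> q; apply: val_inj; exact: etrans (hE _) (sE q).
exists g; split=> //; last by move=> q; apply: inj_h; rewrite hg.
apply/continuousP => V [W oW WV].
(* The preimage of V under g is the trace on Fix of the projection of the set of
   vectors that are rescaled into W. *)
exists (@p R n @`
  (set_val @^-1` [set z | 0 < inertia m z /\ W (normalize m z)]))%classic.
  exact/p_open/open_normalize_preimage.
have Wpi y : V (\pi_(CCbar m mm alpha) y) <-> W (set_val y).
  by rewrite -[V _]/((\pi_(CCbar m mm alpha) @^-1` V)%classic y) -WV.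
apply/seteqP; split=> [q [z [z0 Wz] zq]|q Vq] /=.
- have Fz : Fix m mm alpha (p z) by rewrite zq; exact: set_valP.
  pose y : CC1 m mm alpha := exist _ (normalize m (set_val z))
     (mem_set (normalize_Fix m0 mmC Fz)).
  suff -> : g q = \pi_(CCbar m mm alpha) y by exact/Wpi.
  by apply/CC1_orbitP; rewrite sE -zq; apply/esym/p_normalize.
- have [_ [_ I1]] := set_valP (s q).
  exists (punctured_of_CC1 (s q)); last exact: sE.
  split; first by rewrite [inertia _ _]I1.
  by rewrite normalize_id //; exact/Wpi.
Qed.
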